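(* The irredundant Picard–Fuchs system is not always Fuchsian: it can have a regular but non-Fuchsian singular point at infinity. That is, there exist a polynomial $H\in\mathbb{C}[x,y]$ of some degree $n+1$ that is regular at infinity and polynomial 1-forms $\omega_1,\dots,\omega_\mu$, $\mu=n^2$, with $\sum_{i=1}^\mu\deg\omega_i=\mu\deg H$ and with $d\omega_1,\dots,d\omega_\mu$ generating $\Lambda^2/dH\wedge\Lambda^1$ as a complex vector space, such that the irredundant Picard–Fuchs system $$(t-A)\dot X(t)=(B_0+B_1t)X(t)$$ of $\omega_1,\dots,\omega_\mu$ has at $t=\infty$ a regular singular point which is not Fuchsian.
   Context: A polynomial $H\in\mathbb{C}[x,y]$ of degree $n+1$ ($n\ge 1$) is called regular at infinity if its highest homogeneous part $\widehat H$ is a product of pairwise different (pairwise non-proportional) linear factors. $\Lambda^k$ denotes the space of polynomial $k$-forms on $\mathbb{C}^2$; $\Lambda^2/dH\wedge\Lambda^1\cong\mathbb{C}[x,y]/\langle H_x,H_y\rangle$ via $Q\,dx\wedge dy\mapsto Q$, a space of dimension $\mu=n^2$. Degrees of forms are computed with $\deg dx=\deg dy=1$, e.g. $\deg(x^iy^j\,dx)=i+j+1$. For $t$ not a critical value of $H$, $H_1(\{H=t\},\mathbb{Z})$ is generated by $\mu$ vanishing cycles $\delta_1(t),\dots,\delta_\mu(t)$, fixed as continuous (multivalued in $t$) families; the period matrix is $X(t)=\bigl(\oint_{\delta_j(t)}\omega_i\bigr)_{i,j}$ (rows: forms, columns: cycles). The irredundant Picard–Fuchs system is built as follows. Write $H\,d\omega_i=dH\wedge\eta_i+\sum_{j=1}^\mu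 a_{ij}\,d\omega_j$ with $A=(a_{ij})$ constant and polynomial 1-forms $\eta_i$ with $\deg\eta_i\le\deg\omega_i$ (such a representation exists). The constant matrices $B_0,B_1$ are those for which $\oint_{\delta(t)}\eta_i=\sum_{j}(B_0+tB_1)_{ij}\oint_{\delta(t)}\omega_j$ for every $i$ and every continuous family of cycles $\delta(t)\subset\{H=t\}$ (such matrices exist and are unique). Then $(t-A)\dot X=(B_0+B_1t)X$. A singular point $t_0\in\mathbb{C}\cup\{\infty\}$ of a linear system $\dot X=M(t)X$ with rational $M$ is Fuchsian if the matrix-valued 1-form $M(t)\,dt$ has a pole of first order at $t_0$ (at $t_0=\infty$: with respect to the local coordinate $1/t$, i.e. $M(t)=O(1/t)$ as $t\to\infty$); it is regular if all solutions grow at most polynomially in the inverse of the local coordinate as the point is approached in sectors. *)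

(* Defs.v *)
From HB Require Import structures.
From mathcomp Require Import all_boot all_order all_algebra.
From mathcomp Require Import complex.
(* mpoly's notations clash with those of mathcomp-analysis. *)
From mathcomp Require Import -(notations) mpoly.
From mathcomp Require Import all_classical all_reals all_analysis.

Set Implicit Arguments.
Unset Strict Implicit.
Unset Printing Implicit Defensive.

Import Order.TTheory GRing.Theory Num.Theory numFieldNormedType.Exports.
Local Open Scope ring_scope.
Local Open Scope complex_scope.
Local Open Scope classical_set_scope.

(* The coordinates x and y on C^2 have indices ord0 and ord_max in 'I_2; a
   point of C^2 is a function 'I_2 -> R[i], as expected by meval. *)

Section Forms.
Variable R : realType.
Local Notation C := (R[i]).
Local Notation Cxy := (mpoly 2 C).

(* w stands for w ord0 dx + w ord_max dy. *)
Definition form1 := 'I_2 -> Cxy.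

(* deg dx = deg dy = 1, so deg (P dx + Q dy) = max (deg P) (deg Q) + 1, and
   msize is the degree plus one; the zero form gets degree 0. *)
Definition form_deg (w : form1) : nat := maxn (msize (w ord0)) (msize (w ord_max)).

(* 2-forms are identified with their coefficient at dx /\ dy. *)
Definition ext_deriv (w : form1) : Cxy :=
  mderiv ord0 (w ord_max) - mderiv ord_max (w ord0).

Definition dwedge (H : Cxy) (w : form1) : Cxy :=
  mderiv ord0 H * w ord_max - mderiv ord_max H * w ord0.

(* H has degree d and its homogeneous part of degree d is a product of d
   pairwise non-proportional linear factors. *)
Definition regular_at_infinity (d : nat) (H : Cxy) : Prop :=
  msize H = d.+1 /\
  exists a b : 'I_d -> C,
    (forall k l : 'I_d, k != l -> a k * b l - a l * b k != 0) /\
    pihomog mdeg d H =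
      \prod_(k < d) (a k *: mpolyX C (mnm1 ord0) + b k *: mpolyX C (mnm1 ord_max)).

Definition generates_quotient (m : nat) (H : Cxy) (w : 'I_m -> form1) : Prop :=
  forall Q : Cxy, exists (c : 'I_m -> C) (eta : form1),
    Q = \sum_(i < m) c i *: ext_deriv (w i) + dwedge H eta.

Definition critical_value (H : Cxy) (t : C) : Prop :=
  exists p : 'I_2 -> C,
    [/\ meval p H = t, meval p (mderiv ord0 H) = 0
      & meval p (mderiv ord_max H) = 0].

End Forms.

Section Cycles.
Variable R : realType.
Local Notation C := (R[i]).
Local Notation Cxy := (mpoly 2 C).

Definition C1 (f : R -> R) : Prop :=
  (forall s, derivable f s 1) /\ continuous (derive1 f).

(* A closed curve is a map of period 1; only [0, 1] matters for integrals. *)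
Definition curve := R -> 'I_2 -> C.

Definition loop_in_level (H : Cxy) (t : C) (g : curve) : Prop :=
  [/\ forall k, C1 (fun s => complex.Re (g s k)),
      forall k, C1 (fun s => complex.Im (g s k)),
      forall s, g (s + 1) = g s
    & forall s, meval (g s) H = t].

Definition velocity (g : curve) (s : R) (k : 'I_2) : C :=
  derive1 (fun u => complex.Re (g u k)) s
    +i* derive1 (fun u => complex.Im (g u k)) s.

Definition pullback (w : form1 R) (g : curve) (s : R) : C :=
  \sum_(k < 2) meval (g s) (w k) * velocity g s k.

Definition loop_integral (w : form1 R) (g : curve) : C :=
  (\int[@lebesgue_measure R]_(s in `[0, 1]) complex.Re (pullback w g s))
    +i* (\int[@lebesgue_measure R]_(s in `[0, 1]) complex.Im (pullback w g s)).

(* An integral 1-cycle is represented by a combination of C^1 loops g l with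
   integer multiplicities mu l: every class of H_1({H = t}, Z) has such a
   representative when the level curve is smooth, and the integrals of
   polynomial 1-forms depend only on the class. *)
Definition cycle_integral (w : form1 R) (N : nat) (mu : 'I_N -> int)
    (g : 'I_N -> curve) : C :=
  \sum_(l < N) (mu l)%:~R * loop_integral w (g l).

(* The loops of a continuous family of cycles over an open set U of noncritical
   values; a multivalued family is a collection of such single-valued branches.
   The multiplicities do not depend on t. *)
Definition continuous_family (H : Cxy) (U : set C^o) (N : nat)
    (g : C -> 'I_N -> curve) : Prop :=
  [/\ open U,
      forall t, U t -> ~ critical_value H t,
      forall t, U t -> forall l, loop_in_level H t (g t l)
    & forall l k (t : C^o) (s : R), U t ->
        {for (t, s), continuous (fun p : C^o * R => g p.1 l p.2 k : C^o)}].

(* The constant matrices A, B0, B1 are those of the irredundant Picard-Fuchs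
   system (t - A) X' = (B0 + B1 t) X of the forms w. *)
Definition picard_fuchs (m : nat) (H : Cxy) (w : 'I_m -> form1 R)
    (A B0 B1 : 'M[C]_m) : Prop :=
  exists eta : 'I_m -> form1 R,
    [/\ forall i, H * ext_deriv (w i) =
          dwedge H (eta i) + \sum_(j < m) A i j *: ext_deriv (w j),
        forall i, (form_deg (eta i) <= form_deg (w i))%N
      & forall (U : set C^o) (N : nat) (mu : 'I_N -> int)
               (g : C -> 'I_N -> curve), continuous_family H U g ->
          forall i (t : C), U t ->
            cycle_integral (eta i) mu (g t) =
            \sum_(j < m) (B0 + t *: B1) i j * cycle_integral (w j) mu (g t)].

End Cycles.

Section LinearSystems.
Variable R : realType.
Local Notation C := (R[i]).

(* The system X' = pf_matrix A B0 B1 t *m X is (t - A) X' = (B0 + B1 t) X. *)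
Definition pf_matrix (m : nat) (A B0 B1 : 'M[C]_m) (t : C) : 'M[C]_m :=
  invmx (t%:M - A) *m (B0 + t *: B1).

Definition sector (rho alpha beta : R) : set C :=
  [set t | exists r theta : R,
     [/\ rho < r, alpha < theta, theta < beta
       & t = (r * cos theta) +i* (r * sin theta)]].

(* The derivative is taken over the field C, i.e. it is the complex one. *)
Definition solution_on (m : nat) (M : C -> 'M[C]_m) (S : set C)
    (X : C -> 'cV[C]_m) : Prop :=
  forall t, S t -> forall i,
    @is_derive C C^o C^o t 1 (fun z => X z i 0) ((M t *m X t) i 0).

(* The inverse of the local coordinate 1/t at infinity is t itself. *)
Definition regular_singular_at_infinity (m : nat) (M : C -> 'M[C]_m) : Prop :=
  forall (rho alpha beta : R) (X : C -> 'cV[C]_m),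
    0 < rho -> beta <= alpha + 2 * pi ->
    solution_on M (sector rho alpha beta) X ->
    exists (N : nat) (K rho' : R),
      forall t, sector rho alpha beta t -> rho'%:C < `|t| ->
        forall i, `|X t i 0| <= K%:C * `|t| ^+ N.

(* M(t) = O(1/t), i.e. M(t) dt has at most a simple pole at infinity. *)
Definition fuchsian_at_infinity (m : nat) (M : C -> 'M[C]_m) : Prop :=
  exists K rho : R, forall t : C, rho%:C < `|t| ->
    forall i j, `|M t i j| <= K%:C / `|t|.

End LinearSystems.

(* Main.v *)
Require Import Defs.
From HB Require Import structures.
From mathcomp Require Import all_boot all_order all_algebra.
From mathcomp Require Import complex.
From mathcomp Require Import -(notations) mpoly.
From mathcomp Require Import all_classical all_reals all_analysis.
From mathcomp Require Import ring lra.

Set Implicit Arguments.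
Unset Strict Implicit.
Unset Printing Implicit Defensive.

Import Order.TTheory GRing.Theory Num.Theory numFieldNormedType.Exports.
Local Open Scope ring_scope.
Local Open Scope complex_scope.

(** For the homogeneous [H = x^5 - y^5] the monomial forms with
    [d w_ab = x^a y^b dx dy], [0 <= a, b <= 3], have [A = 0] and periods
    [c t^((a + b + 2) / 5)]: Euler's identity shows that
    [(x^a y^b / 5) (x dy - y dx)] equals [(a + b + 2) / 5 * w_ab] up to an exact
    form. In the highest form [w_33], of degree 8, one may add the form
    [H w_00] of smaller degree 7: this keeps all degrees, and changes [d w_33]
    by an element of the Jacobian ideal. On periods it replaces [X_33] by
    [X_33 + t X_00], which mixes the exponents 8/5 and 7/5, so that
    [t X_33' = (8/5) X_33 - (1/5) t X_00] and [B1 <> 0]: the system is not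
    Fuchsian. It remains regular because [X_33 - t X_00] again satisfies a scalar
    Euler equation [t Y' = (m / 5) Y]. *)

(** * Polynomials in two variables *)

Section Monomials.
Variable K : fieldType.
Implicit Types p q : mpoly 2 K.

Definition vx : mpoly 2 K := mpolyX K (mnm1 ord0).
Definition vy : mpoly 2 K := mpolyX K (mnm1 ord_max).
Definition mono (a b : nat) : mpoly 2 K := vx ^+ a * vy ^+ b.

Lemma mpolyX_mono (m : multinom 2) : mpolyX K m = mono (m ord0) (m ord_max).
Proof.
rewrite mpolyXE_id !big_ord_recl big_ord0 mulr1 /mono /vx /vy.
by congr (mpolyX _ (mnm1 _) ^+ (m _) * mpolyX _ (mnm1 _) ^+ (m _)); apply: val_inj.
Qed.

Definition mnm2 (a b : nat) : multinom 2 :=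
  Multinom [tuple a; b].

Lemma monoE a b : mono a b = mpolyX K (mnm2 a b).
Proof. by rewrite mpolyX_mono. Qed.

Lemma mdeg_mnm2 a b : mdeg (mnm2 a b) = (a + b)%N.
Proof. by rewrite mdegE !big_ord_recl big_ord0 addn0. Qed.

Lemma msize_mono a b : msize (mono a b) = (a + b).+1.
Proof. by rewrite monoE msizeX mdeg_mnm2. Qed.

Lemma monoM a b c d : mono a b * mono c d = mono (a + c) (b + d).
Proof. by rewrite /mono !exprD; ring. Qed.

Lemma mderivx_mono a b : mderiv ord0 (mono a b) = a%:R *: mono a.-1 b.
Proof.
rewrite monoE mderivX mpolyX_mono /= !mnmE /=; congr (_ *: mono _ _).
  by rewrite subn1.
by rewrite subn0.
Qed.

Lemma mderivy_mono a b : mderiv ord_max (mono a b) = b%:R *: mono a b.-1.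
Proof.
rewrite monoE mderivX mpolyX_mono /= !mnmE /=; congr (_ *: mono _ _).
  by rewrite subn0.
by rewrite subn1.
Qed.

(** The nontrivial inequality comes from applying the bound for sums to [p = (p + q) - q]. *)
Lemma msizeD_proper p q : (msize q < msize p)%N -> msize (p + q) = msize p.
Proof.
move=> qp; apply/eqP; rewrite eqn_leq.
have := mmeasureD_le mdeg p q; rewrite (maxn_idPl (ltnW qp)) => -> /=.
have := mmeasureD_le mdeg (p + q) (- q); rewrite addrK mmeasureN.
by rewrite leq_max [X in _ || X]leqNgt qp orbF.
Qed.

(** Euler's identity for homogeneous polynomials of degree [k]. Reducing the periods uses
    homogeneity only in this form, which is visibly stable under linear combinations. *)
Definition euler (k : nat) p :=
  vx * mderiv ord0 p + vy * mderiv ord_max p = k%:R *: p.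

Lemma euler_mono a b : euler (a + b) (mono a b).
Proof.
rewrite /euler mderivx_mono mderivy_mono -!scalerAr natrD scalerDl.
congr (_ + _).
  by case: a => [|a]; rewrite ?scale0r //= /mono exprS mulrA.
by case: b => [|b]; rewrite ?scale0r //= /mono exprS mulrCA.
Qed.

Lemma eulerZ k c p : euler k p -> euler k (c *: p).
Proof.
rewrite /euler !mderivZ -!scalerAr -scalerDr => ->.
by rewrite !scalerA mulrC.
Qed.

Lemma eulerB k p q : euler k p -> euler k q -> euler k (p - q).
Proof.
rewrite /euler !mderivB !mulrBr scalerBr => <- <-; ring.
Qed.

End Monomials.

(** The hypothesis is the fifth cyclotomic equation, solved for [u ^+ 4] so that [ring] can use it
    as a rewriting rule. A general ring is allowed because [u] will be a constant polynomial. *)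
Lemma subrX5_factor (K : comNzRingType) (x y u : K) :
  u ^+ 4 = - (1 + u + u ^+ 2 + u ^+ 3) ->
  x ^+ 5 - y ^+ 5 =
    (x - y) * (x - u * y) * (x - u ^+ 2 * y) * (x - u ^+ 3 * y) * (x - u ^+ 4 * y).
Proof. by move=> H; ring: H. Qed.

(** * The quintic [x^5 - y^5], its forms and their degrees *)

Section FermatQuintic.
Variable R : realType.
Local Notation C := R[i].
Local Notation Cxy := (mpoly 2 C).
Local Notation vx := (vx C).
Local Notation vy := (vy C).
Local Notation mono := (mono C).

(** The three kinds of forms are [p dy], [q (x dy - y dx)] and the exact form [df]. *)
Definition dyform (p : Cxy) : form1 R := fun k => if k == ord_max then p else 0.
Definition radial (q : Cxy) : form1 R :=
  fun k => if k == ord_max then vx * q else - (vy * q).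
Definition grad (f : Cxy) : form1 R := fun k => mderiv k f.

Lemma ext_deriv_dyform p : ext_deriv (dyform p) = mderiv ord0 p.
Proof. by rewrite /ext_deriv /dyform /= mderiv0 subr0. Qed.

Lemma mderiv_vy : mderiv ord0 vy = 0 /\ mderiv ord_max vy = 1.
Proof.
have -> : vy = mono 0 1 by rewrite /mono expr0 mul1r.
by rewrite mderivx_mono mderivy_mono scale0r scale1r /mono !expr0 mulr1.
Qed.

(** In [p_x (x dy - y dx) + d(y p)] the [dx] terms cancel, and the [dy] coefficient is
    [x p_x + y p_y + p = (k + 1) p]. The exact term has no periods, so periods of radial forms
    become multiples of periods of [p dy]. *)
Lemma radial_dyform k p : euler k p -> forall j,
  radial (mderiv ord0 p) j + grad (vy * p) j = k.+1%:R *: dyform p j.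
Proof.
move=> E j; have [dx_vy dy_vy] := mderiv_vy.
have [->|->] : j = ord0 \/ j = ord_max.
  by case: j => [[|[|//]] lt]; [left|right]; apply: val_inj.
  by rewrite /radial /dyform /= /grad mderivM scaler0 dx_vy mul0r add0r addNr.
rewrite /radial /dyform /= /grad mderivM dy_vy.
by rewrite -natr1 scalerDl -E scale1r mul1r; ring.
Qed.

Definition fermat : Cxy := mono 5 0 - mono 0 5.

(** The [dy] coefficient of [H w_00], where [w_00 = x dy]. *)
Definition resonant_coef : Cxy := mono 6 0 - mono 1 5.

Lemma resonant_coefE : resonant_coef = fermat * vx.
Proof.
by rewrite /resonant_coef /fermat mulrBl; congr (_ - _); rewrite /mono; ring.
Qed.

(* The index [i] encodes the monomial [x^(i / 4) y^(i mod 4)]. *)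
Definition pform (i : nat) : Cxy :=
  (i %/ 4).+1%:R^-1 *: mono (i %/ 4).+1 (i %% 4).

Definition wform (i : 'I_(4 ^ 2)) : form1 R :=
  dyform (pform i + (if i == 15 :> nat then resonant_coef else 0)).

Lemma euler_fermat : euler 5 fermat.
Proof. by apply: eulerB; [exact: (euler_mono C 5 0)|exact: (euler_mono C 0 5)]. Qed.

Lemma euler_resonant_coef : euler 6 resonant_coef.
Proof. by apply: eulerB; [exact: (euler_mono C 6 0)|exact: (euler_mono C 1 5)]. Qed.

Lemma euler_pform i : euler ((i %/ 4).+1 + i %% 4) (pform i).
Proof. by apply: eulerZ; exact: euler_mono. Qed.

(** Wedging [dH] with [x dy - y dx] gives [x H_x + y H_y = 5 H]. Hence [H dw = dH /\ eta] holds with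
    no remainder, which is why [A = 0]. *)
Lemma dwedge_radial q :
  dwedge fermat (fun k => 5^-1 *: radial q k) = fermat * q.
Proof.
rewrite /dwedge /radial /= -!scalerAr -scalerBr.
have -> : mderiv ord0 fermat * (vx * q) - mderiv ord_max fermat * - (vy * q)
   = (vx * mderiv ord0 fermat + vy * mderiv ord_max fermat) * q by ring.
by rewrite euler_fermat -scalerAl scalerA mulVf ?scale1r// pnatr_eq0.
Qed.

Lemma dhomog_mono a b : mono a b \is ishomog1 (a + b)%N mdeg.
Proof. by rewrite monoE dhomogX; apply/eqP; exact: mdeg_mnm2. Qed.

Lemma dhomog_fermat : fermat \is ishomog1 5%N mdeg.
Proof.
by rewrite rpredB//; [exact: (dhomog_mono 5 0)|exact: (dhomog_mono 0 5)].
Qed.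

Lemma meval_mono v a b : meval v (mono a b) = v ord0 ^+ a * v ord_max ^+ b.
Proof. by rewrite /mono mevalM !rmorphXn /= !mevalXU. Qed.

Lemma fermat_neq0 : fermat != 0.
Proof.
apply/eqP => /(congr1 (meval (fun k => (k == ord0)%:R))) /eqP.
by rewrite mevalB !meval_mono /= !expr1n !expr0n !mulr1 mul1r subr0 meval0 oner_eq0.
Qed.

Lemma msize_fermat : msize fermat = 6%N.
Proof.
have H := dhomog_msize dhomog_fermat.
have <- := dhomog_uniq fermat_neq0 H dhomog_fermat.
by rewrite prednK// lt0n (mmeasure_poly_eq0 mdeg) fermat_neq0.
Qed.

(** A root of the cyclotomic polynomial exists by algebraic closedness. Its order divides the prime
    5, and order 1 would give [5 = 0]. *)
Lemma exists_primitive_5th_root : exists z : C,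
  1 + z + z ^+ 2 + z ^+ 3 + z ^+ 4 = 0 /\ 5.-primitive_root z.
Proof.
have [z rz] := @solve_monicpoly C 4 (fun=> -1) isT.
have Hz : 1 + z + z ^+ 2 + z ^+ 3 + z ^+ 4 = 0.
  by rewrite rz !big_ord_recl big_ord0 /= /bump /=; ring.
exists z; split=> //.
have z5 : z ^+ 5 = 1.
  apply/eqP; rewrite -subr_eq0; apply/eqP.
  transitivity ((z - 1) * (1 + z + z ^+ 2 + z ^+ 3 + z ^+ 4)); first by ring.
  by rewrite Hz mulr0.
have [m pm m5] := prim_order_exists (isT : (0 < 5)%N) z5.
have /primeP[_ /(_ m m5) /orP[/eqP m1|/eqP <-//]] : prime 5 by [].
move: (prim_expr_order pm) Hz; rewrite m1 expr1 => ->; rewrite !expr1n.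
have -> : 1 + 1 + 1 + 1 + 1 = 5%:R :> C by ring.
by move/eqP; rewrite pnatr_eq0.
Qed.

Lemma fermat_factors (z : C) : 1 + z + z ^+ 2 + z ^+ 3 + z ^+ 4 = 0 ->
  fermat = \prod_(k < 5) (1 *: vx + (- z ^+ k) *: vy).
Proof.
move=> Hz; pose u := mpolyC 2 z.
have cX k : mpolyC 2 (z ^+ k) = u ^+ k.
  by elim: k => [|k IH]; rewrite ?expr0 ?mpolyC1// !exprS mpolyCM IH.
have Hu : u ^+ 4 = - (1 + u + u ^+ 2 + u ^+ 3).
  apply/eqP; rewrite -addr_eq0 addrC -(mpolyC1 2 C) -!cX -!mpolyCD.
  by rewrite Hz mpolyC0.
have -> : \prod_(k < 5) (1 *: vx + (- z ^+ k) *: vy) = \prod_(k < 5) (vx - u ^+ k * vy).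
  by apply: eq_bigr => k _; rewrite scale1r scaleNr -mul_mpolyC cX.
rewrite !big_ord_recl big_ord0 /= /bump /= /fermat /mono.
transitivity (vx ^+ 5 - vy ^+ 5); first by ring.
by rewrite (subrX5_factor vx vy Hu); ring.
Qed.

Lemma regular_fermat : regular_at_infinity 5 fermat.
Proof.
split; first exact: msize_fermat.
have [z [Hz pz]] := exists_primitive_5th_root.
exists (fun=> 1), (fun k => - z ^+ k); split; last first.
  by rewrite pihomog_dE ?dhomog_fermat// (fermat_factors Hz).
(* The determinant of two factors is [z ^+ k - z ^+ l], nonzero for distinct exponents below the
   order of [z]. *)
move=> k l kl; rewrite !mul1r opprK addrC subr_eq0.
by rewrite (eq_prim_root_expr pz) !modn_small.
Qed.

Lemma msize_resonant_coef : (msize resonant_coef <= 7)%N.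
Proof.
apply: leq_trans (mmeasureD_le _ _ _) _.
by rewrite mmeasureN !msize_mono.
Qed.

Lemma form_deg_dyform p : form_deg (dyform p) = msize p.
Proof. by rewrite /form_deg /dyform /= mmeasure0 max0n. Qed.

Lemma msize_pform i : msize (pform i) = (i %/ 4 + i %% 4).+2.
Proof. by rewrite /pform msizeZ ?msize_mono// invr_eq0 pnatr_eq0. Qed.

Lemma form_deg_wform i : form_deg (wform i) = (i %/ 4 + i %% 4).+2.
Proof.
rewrite form_deg_dyform -msize_pform; case: eqP => [i15|_]; last by rewrite addr0.
(* At index 15 the monomial has polynomial degree 7 and the perturbation at most 6, so the degree of
   the form is unaffected. *)
by rewrite msizeD_proper// msize_pform i15 ltnS msize_resonant_coef.
Qed.

Lemma sum_form_deg : (\sum_(i < 4 ^ 2) form_deg (wform i) = 4 ^ 2 * 5)%N.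
Proof.
under eq_bigr do rewrite form_deg_wform.
by rewrite !big_ord_recl big_ord0.
Qed.

Lemma mderiv_pform i : mderiv ord0 (pform i) = mono (i %/ 4) (i %% 4).
Proof. by rewrite mderivZ mderivx_mono scalerA mulVf ?scale1r// pnatr_eq0. Qed.

Lemma mderiv_resonant_coef : mderiv ord0 resonant_coef = 6 *: mono 5 0 - mono 0 5.
Proof. by rewrite mderivB !mderivx_mono scale1r. Qed.

Lemma msize_radial (q : Cxy) (k : nat) : (msize q <= k)%N ->
  (form_deg (fun j => 5^-1 *: radial q j) <= k.+1)%N.
Proof.
move=> qk; have c0 : (5^-1 : C) != 0 by rewrite invr_eq0 pnatr_eq0.
have H (v : Cxy) : msize v = 2%N -> (msize (v * q) <= k.+1)%N.
  move=> v2; have [->|q0] := eqVneq q 0; first by rewrite mulr0 mmeasure0.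
  by rewrite msizeM// ?v2// -(mmeasure_poly_eq0 mdeg) v2.
rewrite /form_deg /radial /= !msizeZ// mmeasureN geq_max !H//.
- by rewrite msizeX mdeg1.
- by rewrite msizeX mdeg1.
Qed.

(** The radial form raises [msize] by one, exactly what differentiation took away. At index 15 the
    derivative of the perturbation has degree 5, below the degree 6 of [x^3 y^3]. *)
Lemma form_deg_eta i :
  (form_deg (fun j => (5^-1 : C) *: radial (ext_deriv (wform i)) j)
    <= form_deg (wform i))%N.
Proof.
rewrite form_deg_wform ext_deriv_dyform mderivD mderiv_pform.
apply: msize_radial; apply: leq_trans (mmeasureD_le _ _ _) _.
rewrite msize_mono geq_max leqnn /=; case: eqP => [->|_]; last first.
  by rewrite mderiv0 mmeasure0.
rewrite mderiv_resonant_coef; apply: leq_trans (mmeasureD_le _ _ _) _.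
by rewrite mmeasureN msizeZ ?pnatr_eq0// !msize_mono.
Qed.

(** * Generation of the quotient by the Jacobian ideal *)

Definition span_quot (Q : Cxy) := exists (c : 'I_(4 ^ 2) -> C) (eta : form1 R),
    Q = \sum_(i < 4 ^ 2) c i *: ext_deriv (wform i) + dwedge fermat eta.

Lemma span_quotD Q1 Q2 : span_quot Q1 -> span_quot Q2 -> span_quot (Q1 + Q2).
Proof.
move=> [c1 [e1 ->]] [c2 [e2 ->]].
exists (fun i => c1 i + c2 i), (fun k => e1 k + e2 k) => /=.
under [in RHS]eq_bigr do rewrite scalerDl.
by rewrite big_split /dwedge /=; ring.
Qed.

Lemma span_quotZ a Q : span_quot Q -> span_quot (a *: Q).
Proof.
move=> [c [e ->]].
exists (fun i => a * c i), (fun k => a *: e k) => /=.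
under [in RHS]eq_bigr do rewrite -scalerA.
by rewrite -scaler_sumr /dwedge -!scalerAr -scalerBr -scalerDr.
Qed.

Lemma span_quot_jac e : span_quot (dwedge fermat e).
Proof.
by exists (fun=> 0), e; rewrite big1 ?add0r// => i _; rewrite scale0r.
Qed.

(** Such monomials lie in the Jacobian ideal, generated by [H_x = 5 x^4] and [H_y = - 5 y^4]. *)
Lemma span_quot_mono_high a b : (4 <= a)%N || (4 <= b)%N -> span_quot (mono a b).
Proof.
have n5 : (5 : C) != 0 by rewrite pnatr_eq0.
case/orP=> [a4|b4].
  have := span_quot_jac (dyform (5^-1 *: mono (a - 4) b)).
  rewrite /dwedge /dyform /= mulr0 subr0 mderivB !mderivx_mono scale0r subr0.
  by rewrite -scalerAr -scalerAl scalerA mulVf// scale1r monoM subnKC.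
have := span_quot_jac (fun k => if k == ord0 then 5^-1 *: mono a (b - 4) else 0).
rewrite /dwedge /dyform /= mulr0 sub0r mderivB !mderivy_mono scale0r sub0r.
by rewrite mulNr opprK -scalerAr -scalerAl scalerA mulVf// scale1r monoM subnKC.
Qed.

Lemma span_quot_ext_deriv i : span_quot (ext_deriv (wform i)).
Proof.
exists (fun j => (j == i)%:R), (fun=> 0).
rewrite (bigD1 i)//= eqxx scale1r big1 => [|j /negPf ->]; last by rewrite scale0r.
by rewrite /dwedge !mulr0 subr0 !addr0.
Qed.

Lemma span_quot_mono a b : span_quot (mono a b).
Proof.
case: (leqP 4 a) => [a4|a4]; first by apply: span_quot_mono_high; rewrite a4.
case: (leqP 4 b) => [b4|b4]; first by apply: span_quot_mono_high; rewrite b4 orbT.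
have lt : (a * 4 + b < 4 ^ 2)%N.
  by rewrite (leq_trans (n:= a * 4 + 4))// ?ltn_add2l// -mulSnr leq_mul2r a4 orbT.
have := span_quot_ext_deriv (Ordinal lt).
rewrite ext_deriv_dyform mderivD mderiv_pform /= divnMDl// modnMDl.
rewrite (divn_small b4) (modn_small b4) addn0.
case: eqP => _; last by rewrite mderiv0 addr0.
rewrite mderiv_resonant_coef => S.
(* At index 15 the differential is [x^3 y^3 + 6 x^5 - y^5]; the last two terms belong to the
   Jacobian ideal and can be subtracted. *)
rewrite -[X in span_quot X](addrK (6 *: mono 5 0 - mono 0 5)).
apply: span_quotD => //; rewrite opprB; apply: span_quotD.
  exact: span_quot_mono_high.
by rewrite -scaleNr; apply: span_quotZ; exact: span_quot_mono_high.
Qed.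

Lemma generates_wform : generates_quotient fermat wform.
Proof.
move=> Q; rewrite -/(span_quot Q); elim/mpolyind: Q => [|c m p _ _ Sp].
  by rewrite -(scale0r (mono 0 0)); apply: span_quotZ; exact: span_quot_mono.
apply: span_quotD => //; apply: span_quotZ; rewrite mpolyX_mono.
exact: span_quot_mono.
Qed.

End FermatQuintic.

(** * Integrals along loops *)

Section Curves.
Variable R : realType.
Local Notation C := R[i].
Local Notation Cxy := (mpoly 2 C).
Implicit Types (f h : R -> C) (p q : Cxy).
Local Open Scope classical_set_scope.

(** Derivatives and continuity of complex functions of a real variable are taken componentwise, as
    [velocity] and [loop_integral] do. *)
Definition cderive f (s : R) (d : C) :=
  is_derive s (1 : R) (fun u => complex.Re (f u)) (complex.Re d) /\
  is_derive s (1 : R) (fun u => complex.Im (f u)) (complex.Im d).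

Definition ccont f :=
  continuous (fun u => complex.Re (f u)) /\ continuous (fun u => complex.Im (f u)).

Lemma cderive_cst (c : C) s : cderive (fun=> c) s 0.
Proof. by split; exact: is_derive_cst. Qed.

Lemma ReD (x y : C) : complex.Re (x + y) = complex.Re x + complex.Re y.
Proof. by case: x y => ? ? []. Qed.
Lemma ImD (x y : C) : complex.Im (x + y) = complex.Im x + complex.Im y.
Proof. by case: x y => ? ? []. Qed.
Lemma ReB (x y : C) : complex.Re (x - y) = complex.Re x - complex.Re y.
Proof. by case: x y => ? ? []. Qed.
Lemma ImB (x y : C) : complex.Im (x - y) = complex.Im x - complex.Im y.
Proof. by case: x y => ? ? []. Qed.
Lemma ReM (x y : C) :
  complex.Re (x * y) = complex.Re x * complex.Re y - complex.Im x * complex.Im y.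
Proof. by case: x y => ? ? []. Qed.
Lemma ImM (x y : C) :
  complex.Im (x * y) = complex.Re x * complex.Im y + complex.Im x * complex.Re y.
Proof. by case: x y => ? ? []. Qed.

Lemma cderiveD f h s df dh : cderive f s df -> cderive h s dh ->
  cderive (fun u => f u + h u) s (df + dh).
Proof.
move=> [f1 f2] [h1 h2]; split.
  under eq_fun do rewrite ReD; rewrite ReD; exact: is_deriveD.
under eq_fun do rewrite ImD; rewrite ImD; exact: is_deriveD.
Qed.

Lemma cderiveM f h s df dh : cderive f s df -> cderive h s dh ->
  cderive (fun u => f u * h u) s (df * h s + f s * dh).
Proof.
pose rf u := complex.Re (f u); pose jf u := complex.Im (f u).
pose rh u := complex.Re (h u); pose jh u := complex.Im (h u).
rewrite /cderive -/rf -/jf -/rh -/jh => -[f1 f2] [h1 h2]; split.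
  rewrite (_ : (fun u => _) = rf * rh - jf * jh); last by apply: funext => u; rewrite ReM.
  have H := is_deriveB (is_deriveM f1 h1) (is_deriveM f2 h2).
  apply: is_derive_eq H _.
  by rewrite /GRing.scale /= ReD !ReM /rf /jf /rh /jh; ring.
rewrite (_ : (fun u => _) = rf * jh + jf * rh); last by apply: funext => u; rewrite ImM.
apply: is_derive_eq (is_deriveD (is_deriveM f1 h2) (is_deriveM f2 h1)) _.
by rewrite /GRing.scale /= ImD !ImM /rf /jf /rh /jh; ring.
Qed.

Lemma ccontD f h : ccont f -> ccont h -> ccont (fun u => f u + h u).
Proof.
move=> [f1 f2] [h1 h2]; split.
  by under eq_fun do rewrite ReD; move=> x; apply: cvgD; [exact: f1|exact: h1].
by under eq_fun do rewrite ImD; move=> x; apply: cvgD; [exact: f2|exact: h2].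
Qed.

Lemma ccontM f h : ccont f -> ccont h -> ccont (fun u => f u * h u).
Proof.
move=> [f1 f2] [h1 h2]; split.
  under eq_fun do rewrite ReM; move=> x.
  by apply: cvgB; apply: cvgM; [exact: f1|exact: h1|exact: f2|exact: h2].
under eq_fun do rewrite ImM; move=> x.
by apply: cvgD; apply: cvgM; [exact: f1|exact: h2|exact: f2|exact: h1].
Qed.

Lemma cderive_ccont f df : (forall s, cderive f s (df s)) -> ccont f.
Proof.
move=> H; split=> x; apply/differentiable_continuous/derivable1_diffP.
  by have [[]] := H x.
by have [_ []] := H x.
Qed.

(** [loop_integral w g] is convertible to [cint (pullback w g)]; later proofs switch between the
    two. *)
Definition cint f : C :=
  (\int[@lebesgue_measure R]_(s in `[0, 1]) complex.Re (f s))
    +i* (\int[@lebesgue_measure R]_(s in `[0, 1]) complex.Im (f s)).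

Lemma integrable01 (u : R -> R) : continuous u ->
  (@lebesgue_measure R).-integrable `[0, 1] (EFin \o u).
Proof.
move=> cu; apply: continuous_compact_integrable; first exact: segment_compact.
exact: continuous_subspaceT.
Qed.

Lemma cintD f h : ccont f -> ccont h -> cint (fun s => f s + h s) = cint f + cint h.
Proof.
move=> [f1 f2] [h1 h2]; rewrite /cint; apply/eqP; rewrite eq_complex /=.
under eq_Rintegral do rewrite ReD.
under [X in _ && (X == _)]eq_Rintegral do rewrite ImD.
by rewrite !RintegralD ?eqxx//; exact: integrable01.
Qed.

Lemma cintZ (c : C) f : ccont f -> cint (fun s => c * f s) = c * cint f.
Proof.
move=> [f1 f2]; rewrite /cint; apply/eqP; rewrite eq_complex ReM ImM /=.
have cZ (a : R) (u : R -> R) : continuous u -> continuous (fun s => a * u s).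
  by move=> cu x; apply: cvgM; [exact: cvg_cst|exact: cu].
under eq_Rintegral do rewrite ReM.
under [X in _ && (X == _)]eq_Rintegral do rewrite ImM.
rewrite RintegralB//; [|exact/integrable01/cZ..].
rewrite RintegralD//; [|exact/integrable01/cZ..].
by rewrite !RintegralZl ?eqxx//; exact: integrable01.
Qed.

Lemma FTC01 (F u : R -> R) : (forall s, is_derive s (1 : R) F (u s)) -> continuous u ->
  \int[@lebesgue_measure R]_(s in `[0, 1]) u s = F 1 - F 0.
Proof.
move=> dF cu; have cF : continuous F.
  by move=> x; apply/differentiable_continuous/derivable1_diffP; have [] := dF x.
rewrite /Rintegral (@continuous_FTC2 _ u F)//=.
- exact: continuous_subspaceT.
- split=> [x _||]; first by have [] := dF x.
  + exact: cvg_at_right_filter (cF 0).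
  + exact: cvg_at_left_filter (cF 1).
- by move=> x _; rewrite derive1E; apply: derive_val.
Qed.

Lemma cint_derive F f : (forall s, cderive F s (f s)) -> ccont f -> cint f = F 1 - F 0.
Proof.
move=> dF [c1 c2]; rewrite /cint.
have -> := FTC01 (fun s => (dF s).1) c1; have -> := FTC01 (fun s => (dF s).2) c2.
by case: (F 1) => ? ?; case: (F 0).
Qed.

Section OneLoop.
Variables (g : curve R).
Hypothesis gRe : forall k, C1 (fun s => complex.Re (g s k)).
Hypothesis gIm : forall k, C1 (fun s => complex.Im (g s k)).

Lemma cderive_coord k s : cderive (fun u => g u k) s (velocity g s k).
Proof.
split; rewrite /velocity /= derive1E; apply/derivableP.
  by have [+ _] := gRe k; exact.
by have [+ _] := gIm k; exact.
Qed.

Lemma ccont_velocity k : ccont (fun s => velocity g s k).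
Proof. by split; [have [] := gRe k|have [] := gIm k]. Qed.

(** The chain rule for polynomials, by induction: it holds for constants and coordinates and passes
    to products and sums. *)
Lemma cderive_meval p s : cderive (fun u => meval (g u) p) s
  (\sum_(k < 2) meval (g s) (mderiv k p) * velocity g s k).
Proof.
pose D q := cderive (fun u => meval (g u) q) s
  (\sum_(k < 2) meval (g s) (mderiv k q) * velocity g s k).
rewrite -/(D p).
have dM q1 q2 : D q1 -> D q2 -> D (q1 * q2).
  move=> D1 D2; have := cderiveM D1 D2; congr cderive.
    by apply: funext => u; rewrite mevalM.
  rewrite mulr_suml mulr_sumr -big_split; apply: eq_bigr => k _.
  by rewrite mderivM mevalD !mevalM /=; ring.
have dC c : D (mpolyC 2 c).
  have := cderive_cst c s; congr cderive; first by apply: funext => u; rewrite mevalC.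
  by rewrite big1 // => k _; rewrite mderivC meval0 mul0r.
have dX (i : 'I_2) : D (mpolyX C (mnm1 i)).
  have := cderive_coord i s; congr cderive; first by apply: funext => u; rewrite mevalXU.
  rewrite (bigD1 i)//= big1 => [|k /negPf ki]; rewrite mderivX mnmE.
    by rewrite eqxx scale1r addr0 mevalX big1 ?mul1r// => j _; rewrite !mnmE subnn expr0.
  by rewrite eq_sym ki scale0r meval0 mul0r.
have dXn q1 n : D q1 -> D (q1 ^+ n).
  move=> D1; elim: n => [|n IH]; first by rewrite expr0 -mpolyC1.
  by rewrite exprS; exact: dM.
elim/mpolyind: p => [|c m p _ _ IH]; first by rewrite -(mpolyC0 2 C).
have Dm : D (c *: mpolyX C m).
  rewrite -mul_mpolyC mpolyX_mono.
  exact: (dM _ _ (dC c) (dM _ _ (dXn _ _ (dX _)) (dXn _ _ (dX _)))).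
have := cderiveD Dm IH; congr cderive; first by apply: funext => u; rewrite mevalD.
by rewrite -big_split; apply: eq_bigr => k _; rewrite mderivD mevalD mulrDl.
Qed.

Lemma ccont_meval p : ccont (fun u => meval (g u) p).
Proof. apply: cderive_ccont => s; exact: cderive_meval. Qed.

Lemma ccont_pullback w : ccont (pullback w g).
Proof.
rewrite /pullback; under eq_fun do rewrite !big_ord_recl big_ord0 addr0.
by apply: ccontD; apply: ccontM; (exact: ccont_meval || exact: ccont_velocity).
Qed.

Lemma loop_integralD w1 w2 :
  loop_integral (fun k => w1 k + w2 k) g = loop_integral w1 g + loop_integral w2 g.
Proof.
rewrite -[RHS]/(cint _ + cint _) -cintD; [|exact: ccont_pullback..].
rewrite -/(cint (pullback _ g)); congr cint; apply: funext => s.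
by rewrite /pullback -big_split; apply: eq_bigr => k _; rewrite mevalD mulrDl.
Qed.

Lemma loop_integralZ c w :
  loop_integral (fun k => c *: w k) g = c * loop_integral w g.
Proof.
rewrite -[RHS]/(c * cint _) -cintZ; last exact: ccont_pullback.
rewrite -/(cint (pullback _ g)); congr cint; apply: funext => s.
by rewrite /pullback mulr_sumr; apply: eq_bigr => k _; rewrite mevalZ mulrA.
Qed.

Hypothesis gper : forall s, g (s + 1) = g s.

(** By the chain rule the pullback of [dp] is the derivative of [p] along the loop, so the integral
    is the difference of the end values, which agree by periodicity. *)
Lemma loop_integral_grad p : loop_integral (grad p) g = 0.
Proof.
rewrite -[LHS]/(cint _) (cint_derive (F := fun u => meval (g u) p)).
- by rewrite -[X in g X]add0r gper subrr.
- by move=> s; exact: cderive_meval.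
- exact: ccont_pullback.
Qed.

End OneLoop.

End Curves.

(** * The Picard-Fuchs system *)

Section PicardFuchs.
Variable R : realType.
Local Notation C := R[i].
Local Notation Cxy := (mpoly 2 C).

Definition fdeg (i : nat) : nat := (i %/ 4 + i %% 4).+2.
Definition i0 : 'I_(4 ^ 2) := Ordinal (isT : 0 < 4 ^ 2)%N.
Definition i15 : 'I_(4 ^ 2) := Ordinal (isT : 15 < 4 ^ 2)%N.

(** The diagonal carries the exponents [(a + b + 2) / 5]. The single entry of [pfB1] is the
    difference [7/5 - 8/5] of the factors that the two summands of the perturbed form acquire. *)
Definition pfB0 : 'M[C]_(4 ^ 2) := \matrix_(i, j) ((fdeg i)%:R / 5 *+ (i == j)).
Definition pfB1 : 'M[C]_(4 ^ 2) := \matrix_(i, j) (- 5^-1 *+ ((i == i15) && (j == i0))).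

Lemma sum_pfB (t : C) (f : 'I_(4 ^ 2) -> C) i :
  \sum_(j < 4 ^ 2) (pfB0 + t *: pfB1) i j * f j =
  (fdeg i)%:R / 5 * f i - (t / 5 * f i0) *+ (i == i15).
Proof.
have D1 : \sum_(j < 4 ^ 2) pfB0 i j * f j = (fdeg i)%:R / 5 * f i.
  rewrite (bigD1 i)//= big1 => [|j]; rewrite mxE ?eqxx ?addr0// eq_sym => /negPf ->.
  by rewrite mul0r.
have D2 : \sum_(j < 4 ^ 2) pfB1 i j * f j = - (5^-1 * f i0) *+ (i == i15).
  rewrite (bigD1 i0)//= big1 => [|j]; rewrite mxE.
    by rewrite eqxx andbT addr0 mulrnAl mulNr.
  by move=> /negPf ->; rewrite andbF mul0r.
transitivity (\sum_(j < 4 ^ 2) (pfB0 i j * f j + t * (pfB1 i j * f j))).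
  apply: eq_bigr => j _; rewrite mulrA -mulrDl; congr (_ * _).
  by rewrite [LHS]mxE [X in _ + X]mxE.
rewrite big_split /= -mulr_sumr D1 D2.
by case: (i == i15); rewrite ?mulr1n ?mulr0n ?oppr0; ring.
Qed.

Lemma dyformD (p q : Cxy) : dyform (p + q) = fun k => dyform p k + dyform q k.
Proof. by apply: funext => k; rewrite /dyform; case: ifP; rewrite ?addr0. Qed.

Lemma radialD (p q : Cxy) : radial (p + q) = fun k => radial p k + radial q k.
Proof. by apply: funext => k; rewrite /radial; case: ifP; rewrite mulrDr ?opprD. Qed.

Lemma wform0 : wform R i0 = dyform (vx C).
Proof.
by rewrite /wform /pform /= addr0 invr1 scale1r /mono expr1 expr0 mulr1.
Qed.

Section Loop.
Variables (t : C) (g : curve R).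
Hypothesis gt : loop_in_level (fermat R) t g.

Lemma loop_integral_radial k p : euler k p ->
  loop_integral (radial (mderiv ord0 p)) g = k.+1%:R * loop_integral (dyform p) g.
Proof.
case: gt => gRe gIm gper _ E; rewrite -(loop_integralZ gRe gIm).
have <- : (fun j => radial (mderiv ord0 p) j + grad (vy C * p) j) =
    fun j => k.+1%:R *: dyform p j.
  by apply: funext => j; exact: radial_dyform.
by rewrite (loop_integralD gRe gIm) (loop_integral_grad gRe gIm gper) addr0.
Qed.

(** Along the loop the factor [H] of the form is the constant [t]. *)
Lemma loop_integral_resonant :
  loop_integral (dyform (resonant_coef R)) g = t * loop_integral (wform R i0) g.
Proof.
case: gt => gRe gIm gper gH; rewrite -(loop_integralZ gRe gIm) wform0 resonant_coefE.
rewrite -/(cint (pullback _ g)) -[RHS]/(cint _); congr cint; apply: funext => s.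
apply: eq_bigr => k _; congr (_ * _); rewrite /dyform; case: ifP.
  by rewrite mevalM gH mevalZ.
by rewrite scaler0.
Qed.

Lemma loop_integral_eta (i : 'I_(4 ^ 2)) :
  loop_integral (fun j => 5^-1 *: radial (ext_deriv (wform R i)) j) g =
  \sum_(j < 4 ^ 2) (pfB0 + t *: pfB1) i j * loop_integral (wform R j) g.
Proof.
rewrite sum_pfB; case: (gt) => gRe gIm gper _; rewrite (loop_integralZ gRe gIm).
(* Needed away from index 15, where the added polynomial is zero. *)
have L0 (w : form1 R) : (forall k, w k = 0) -> loop_integral w g = 0.
  move=> w0; transitivity (loop_integral (fun k => 0 *: w k) g).
    by congr loop_integral; apply: funext => k; rewrite scale0r.
  by rewrite (loop_integralZ gRe gIm) mul0r.
set W0 := loop_integral (wform R i0) g.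
rewrite ext_deriv_dyform mderivD radialD /wform dyformD !(loop_integralD gRe gIm).
have -> := loop_integral_radial (@euler_pform R i); rewrite addSn.
have -> : (i == 15 :> nat) = (i == i15) by [].
case: eqP => [->|_].
  (* With [P] the integral of the unperturbed form and [W0] that of [w_00], the left side is
     [(8 P + 7 t W0) / 5], which is [8/5 (P + t W0) - t/5 W0]. *)
  rewrite (loop_integral_radial (@euler_resonant_coef R)) loop_integral_resonant mulr1n.
  rewrite -/W0 (_ : fdeg i15 = 8%N)// (_ : (_ + _).+2 = 8%N)//.
  by move: (loop_integral _ g) => P; ring.
have z1 : loop_integral (dyform (0 : Cxy)) g = 0.
  by apply: L0 => k; rewrite /dyform if_same.
have z2 : loop_integral (radial (mderiv ord0 (0 : Cxy))) g = 0.
  by apply: L0 => k; rewrite mderiv0 /radial !mulr0 oppr0 if_same.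
by rewrite z1 z2 /fdeg mulr0n; ring.
Qed.

End Loop.

Lemma picard_fuchs_wform : picard_fuchs (fermat R) (wform R) 0 pfB0 pfB1.
Proof.
exists (fun i j => 5^-1 *: radial (ext_deriv (wform R i)) j); split.
- by move=> i; rewrite dwedge_radial big1 ?addr0// => j _; rewrite mxE scale0r.
- by move=> i; exact: form_deg_eta.
move=> U N mu g [_ _ gloop _] i t Ut; rewrite /cycle_integral.
transitivity (\sum_(l < N) \sum_(j < 4 ^ 2)
    (pfB0 + t *: pfB1) i j * ((mu l)%:~R * loop_integral (wform R j) (g t l))).
  apply: eq_bigr => l _; have -> := loop_integral_eta (gloop t Ut l) i.
  by rewrite mulr_sumr; apply: eq_bigr => j _; rewrite mulrCA.
by rewrite exchange_big; apply: eq_bigr => j _; rewrite mulr_sumr.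
Qed.

(** * The system matrix near infinity and the failure of the Fuchsian condition *)

Lemma pf_matrixE (t : C) : t != 0 -> pf_matrix 0 pfB0 pfB1 t = t^-1 *: (pfB0 + t *: pfB1).
Proof. by move=> t0; rewrite /pf_matrix subr0 invmx_scalar mul_scalar_mx. Qed.

Lemma pfB_resonant_entry (t : C) : (pfB0 + t *: pfB1) i15 i0 = - (t / 5).
Proof.
have b0 : pfB0 i15 i0 = 0 by rewrite mxE.
have b1 : pfB1 i15 i0 = - 5^-1 by rewrite mxE.
by rewrite mxE b0 add0r mxE b1 mulrN.
Qed.

(** The entry at [(i15, i0)] is the nonzero constant [- 1/5], which is not [O(1/t)]. *)
Lemma not_fuchsian_pf_matrix : ~ fuchsian_at_infinity (pf_matrix 0 pfB0 pfB1).
Proof.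
move=> [K [rho H]].
(* Chosen beyond [rho] and large enough that [s / 5 <= K] fails. *)
pose s : R := `|K| * 5 + `|rho| + 1.
have s0 : 0 < s by rewrite ltr_wpDl// addr_ge0// mulr_ge0.
have ns : `|s%:C| = s%:C by rewrite ger0_norm// ler0c ltW.
have rs : rho < s.
  by have := ler_norm rho; have := normr_ge0 K; rewrite /s; lra.
have sC0 : s%:C != 0 by rewrite eq_complex /= negb_and gt_eqF.
have := H s%:C; rewrite ns ltcR => /(_ rs i15 i0).
rewrite pf_matrixE// mxE pfB_resonant_entry mulrN mulrA mulVf// mul1r normrN -ns.
rewrite normfV ns ger0_norm// ler_pdivlMr; last by rewrite ltcR.
have -> : (5^-1 * s%:C : C) = (s / 5)%:C.
  by rewrite mulrC rmorphM fmorphV rmorph_nat.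
rewrite lecR; have := ler_norm K; have := normr_ge0 rho; rewrite /s; lra.
Qed.

End PicardFuchs.

(** * Growth of solutions in sectors *)

Section Regular.
Variable R : realType.
Local Notation C := R[i].
Local Open Scope classical_set_scope.

Lemma is_derive_near (K : numFieldType) (f : K^o -> K^o) (x d : K^o) :
  @is_derive K K^o K^o x 1 f d -> forall e : K, 0 < e ->
  \forall y \near x, `|f y - f x - (y - x) * d| <= e * `|y - x|.
Proof.
move=> [df <-] e e0; have /eqaddoP /(_ e e0) := derivable_nbhs df.
rewrite near_simpl => H.
have cx : (fun y : K^o => y - x) @ x --> (0 : K^o).
  rewrite -(subrr x).
  exact: (@cvgB K K^o _ (nbhs x) _ id (cst x) x x (@cvg_id _ _) (@cvg_cst _ _ _ _ _)).
refine (@filterS _ (nbhs x) _ _ _ _ (cx _ H)) => y /=.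
rewrite -![(_ + _ : _ -> _) _]/(_ + _) -![(- _ : _ -> _) _]/(- _) /cst /=.
by rewrite [_ *: 1]mulr1 subrK opprD addrA.
Qed.

Lemma is_derive0_near (f : R -> R) (x : R) :
  (forall e : R, 0 < e -> \forall y \near x, `|f y - f x| <= e * `|y - x|) ->
  is_derive x (1 : R) f 0.
Proof.
move=> H.
have lim0 : (fun h : R => h^-1 *: ((f \o shift x) (h *: (1 : R)) - f x)) @ 0^' -->
    (0 : R).
  apply/cvgr0Pnorm_le => e e0.
  have c0 : (fun h : R => h + x) @ 0^' --> x.
    rewrite -[X in _ --> X]add0r; apply: cvgD; last exact: cvg_cst.
    exact: cvg_within.
  have := c0 _ (H e e0); rewrite near_simpl /= => {}H.
  near=> h; have h0 : h != 0 by near: h; exact: nbhs_dnbhs_neq.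
  rewrite /= [h *: 1]mulr1 normrZ normfV ler_pdivrMl ?normr_gt0// mulrC.
  have : `|f (h + x) - f x| <= e * `|h + x - x| by near: h.
  by rewrite addrK [e * _]mulrC.
split; first by apply: cvgP lim0.
exact: cvg_lim lim0.
Unshelve. all: by end_near. Qed.

Lemma normc_ge_Im (z : C) : `|complex.Im z|%:C <= `|z|.
Proof.
have := normc_ge_Re (z * 'i%C); rewrite ReiNIm normrN normrM.
by rewrite [`|'i%C|]normc_def /= expr0n add0r expr1n sqrtr1 mulr1.
Qed.

Lemma normc_le_ReIm (z : C) : `|z| <= (`|complex.Re z| + `|complex.Im z|)%:C.
Proof.
rewrite {1}(complexE z); apply: le_trans (ler_normD _ _) _.
rewrite normrM [`|'i%C|]normc_def /= expr0n add0r expr1n sqrtr1 mul1r.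
rewrite rmorphD /=.
by rewrite !normc_def /= !expr0n !addr0 !sqrtr_sqr.
Qed.

Lemma cderive_lip (g : R -> C) s v : cderive g s v ->
  exists2 L : R, 0 < L & \forall y \near s, `|g y - g s| <= (L * `|y - s|)%:C.
Proof.
move=> [gr gi].
(* The first-order expansion with error factor 1 costs 1 for each of the two components. *)
exists (`|complex.Re v| + `|complex.Im v| + 2).
  by rewrite ltr_wpDl// addr_ge0.
have := is_derive_near gr ltr01; have := is_derive_near gi ltr01.
apply: filterS2 => y Hi Hr; apply: le_trans (normc_le_ReIm _) _.
rewrite lecR ReB ImB.
have B (a b d : R) : `|a - b * d| <= 1 * `|b| -> `|a| <= `|b| * `|d| + `|b|.
  rewrite mul1r => ab; rewrite -[a](subrK (b * d)) addrC.
  by rewrite (le_trans (ler_normD _ _))// normrM lerD.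
have := B _ _ _ Hi; have := B _ _ _ Hr.
move: `|_ - complex.Re _| `|_ - complex.Im _| => p q.
by move=> H1 H2; apply: le_trans (lerD H1 H2) _; lra.
Qed.

(** A chain rule mixing a derivative over [C] with one over [R]. Since the outer derivative
    vanishes, it suffices to compose the [o] estimate of [Z] with the Lipschitz estimate of [g]. *)
Lemma cderive_comp0 (Z : C -> C) (g : R -> C) s v : cderive g s v ->
  @is_derive C C^o C^o (g s) 1 Z 0 -> cderive (fun u => Z (g u)) s 0.
Proof.
move=> /cderive_lip[L L0 HL] HZ.
have E (e : R) : 0 < e -> \forall y \near s, `|Z (g y) - Z (g s)| <= (e * `|y - s|)%:C.
  move=> e0.
  have eL : 0 < (e / L)%:C :> C by rewrite ltcR divr_gt0.
  have /nbhs_normP[d /= d0 Hd] := is_derive_near HZ eL.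
  (* The radius of the neighbourhood is a positive element of [C], hence real, and can be compared
     with real distances. *)
  have [Im0 d0'] : complex.Im d = 0 /\ 0 < complex.Re d.
    by move: d0; rewrite /= ltcE => /andP[/eqP -> ->].
  have dE : d = (complex.Re d)%:C by rewrite {1}[d]complexE Im0 mulr0 addr0.
  near=> y.
  have Hy : `|g y - g s| <= (L * `|y - s|)%:C by near: y.
  have := Hd (g y); rewrite /= mulr0 subr0 => /(_ _)/le_trans; apply.
    rewrite distrC (le_lt_trans Hy)// dE ltcR -ltr_pdivlMl// distrC.
    by near: y; apply: nbhsx_ballx; rewrite mulr_gt0 ?invr_gt0.
  apply: le_trans (ler_wpM2l (ltW eL) Hy) _.
  by rewrite -rmorphM lecR mulrA divfK ?gt_eqF.
split; apply: is_derive0_near => e /E; apply: filterS => y;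
  rewrite -lecR => /(le_trans _); apply.
  by rewrite -ReB normc_ge_Re.
by rewrite -ImB normc_ge_Im.
Unshelve. all: by end_near. Qed.

Lemma is_derive0_cst (f : R -> R) (x y : R) : x <= y ->
  (forall s, x <= s -> s <= y -> is_derive s (1 : R) f 0) -> f x = f y.
Proof.
move=> xy H.
have [||c _] := @MVT_segment R f (fun=> 0) x y xy.
- by move=> s; rewrite in_itv /= => /andP[/ltW ? /ltW ?]; exact: H.
- apply: derivable_within_continuous => s; rewrite in_itv /= => /andP[? ?].
  by have [] := H s.
by rewrite mul0r => /eqP; rewrite subr_eq0 => /eqP ->.
Qed.

Lemma cderive0_cst (f : R -> C) (x y : R) :
  (forall s, Num.min x y <= s -> s <= Num.max x y -> cderive f s 0) -> f x = f y.
Proof.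
wlog xy : x y / x <= y => [W|].
  case/orP: (le_total x y) => xy H; first exact: W.
  by apply/esym/W => // s; rewrite minC maxC; exact: H.
rewrite min_l// max_r// => H; apply/eqP; rewrite eq_complex; apply/andP; split; apply/eqP.
  apply: (is_derive0_cst (f := fun u => complex.Re (f u))) => // s xs sy.
  by have [] := H s xs sy.
apply: (is_derive0_cst (f := fun u => complex.Im (f u))) => // s xs sy.
by have [] := H s xs sy.
Qed.

(** The vanishing derivative of [Y^5 t^(-k)], with [y = Y], [u = 1/t] and [v = u^(k-1)]. *)
Lemma first_integral_identity (y u v k : C) :
  y ^+ 5 * (k * v * - u ^+ 2) + u * v * (5 * y ^+ 4 * (u * (k / 5 * y))) = 0.
Proof. by field. Qed.

(** This avoids extracting fifth roots: either [y <= 1], or [y <= y ^+ 5]. *)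
Lemma le_fifth_power (k : R) (y x : C) : 0 <= k -> 0 <= y -> 1 <= x ->
  y ^+ 5 = k%:C * x -> y <= (k + 1)%:C * x.
Proof.
move=> k0 y0 x1 yx; have kC : 0 <= k%:C :> C by rewrite ler0c.
have x0 : 0 <= x := le_trans ler01 x1.
rewrite rmorphD /= mulrDl mul1r.
have [y1|/ltW y1] := real_leP (ger0_real y0) (real1 C).
  by rewrite (le_trans y1)// (le_trans x1)// lerDr mulr_ge0.
by rewrite -yx (le_trans (ler_eXnr (isT : (0 < 5)%N) y1))// lerDl.
Qed.

Definition pol (r theta : R) : C := (r * cos theta) +i* (r * sin theta).

Lemma cderive_pol_r r theta : cderive (fun u => pol u theta) r (pol 1 theta).
Proof.
split; rewrite /pol /= mul1r.
  have := is_deriveM (is_derive_id r 1) (is_derive_cst (cos theta) r 1).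
  by move=> H; apply: is_derive_eq H _; rewrite scaler0 add0r; exact: mulr1.
have := is_deriveM (is_derive_id r 1) (is_derive_cst (sin theta) r 1).
by move=> H; apply: is_derive_eq H _; rewrite scaler0 add0r; exact: mulr1.
Qed.

Lemma cderive_pol_theta r theta :
  cderive (fun u => pol r u) theta ((- (r * sin theta)) +i* (r * cos theta)).
Proof.
split; rewrite /pol /=.
  have := is_deriveM (is_derive_cst r theta 1) (is_derive_cos theta).
  by move=> H; apply: is_derive_eq H _; rewrite scaler0 addr0 /GRing.scale /= mulrN.
have := is_deriveM (is_derive_cst r theta 1) (is_derive_sin theta).
by move=> H; apply: is_derive_eq H _; rewrite scaler0 addr0.
Qed.

Section Sector.
Variables (rho alpha beta : R).
Let S := sector rho alpha beta.

(** Two points are joined by a radial segment followed by a circular arc; both stay in the sector, a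
    rectangle in polar coordinates, and [Z] has zero derivative along each. *)
Lemma sector_cst (Z : C -> C) :
  (forall t, S t -> @is_derive C C^o C^o t 1 Z 0) ->
  forall t1 t2, S t1 -> S t2 -> Z t1 = Z t2.
Proof.
move=> H _ _ [r1 [a1 [r1_gt a1_gt a1_lt ->]]] [r2 [a2 [r2_gt a2_gt a2_lt ->]]].
rewrite -/(pol r1 a1) -/(pol r2 a2); transitivity (Z (pol r2 a1)).
  apply: (cderive0_cst (f := fun u => Z (pol u a1))) => s ms sM.
  apply: cderive_comp0 (cderive_pol_r s a1) _; apply: H.
  by exists s, a1; split=> //; rewrite (lt_le_trans _ ms)// lt_min r1_gt.
apply: (cderive0_cst (f := fun u => Z (pol r2 u))) => s ms sM.
apply: cderive_comp0 (cderive_pol_theta r2 s) _; apply: H.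
exists r2, s; split=> //; first by rewrite (lt_le_trans _ ms)// lt_min a1_gt.
by rewrite (le_lt_trans sM)// gt_max a1_lt.
Qed.

Hypothesis rho0 : 0 < rho.

Lemma sector_neq0 t : S t -> t != 0.
Proof.
move=> [r [a [rr _ _ ->]]]; apply/eqP => -[/eqP + /eqP].
have r0 : r != 0 by rewrite gt_eqF// (lt_trans rho0).
rewrite !mulf_eq0 !(negPf r0) /= => /eqP c0 /eqP s0.
by have := cos2Dsin2 a; rewrite c0 s0 expr0n addr0 => /eqP; rewrite eq_sym oner_eq0.
Qed.

(* [Y ^ 5 / t ^ m] is a first integral, hence constant on the connected sector. *)
Lemma euler_equation_growth (m : nat) (Y : C -> C) :
  (forall t, S t -> @is_derive C C^o C^o t 1 Y (t^-1 * (m%:R / 5 * Y t))) ->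
  exists2 K : R, 0 <= K & forall t, S t -> 1 < `|t| -> `|Y t| <= K%:C * `|t| ^+ m.
Proof.
move=> HY.
pose Z : C^o -> C^o := (Y : C^o -> C^o) ^+ 5 * (fun t : C^o => t^-1) ^+ m.
have ZE t : Z t = Y t ^+ 5 * t^-1 ^+ m by rewrite /Z mulrfctE !exprfctE.
have dZ t : S t -> @is_derive C C^o C^o t 1 Z 0.
  move=> St; have t0 := sector_neq0 St.
  have dV : @is_derive C C^o C^o t 1 (fun t : C^o => t^-1) (- t ^- 2).
    split; first by apply: derivableV => //; exact: derivable_id.
    by rewrite deriveV ?derive_id//; exact: mulr1.
  have := is_deriveM (is_deriveX 5 (HY t St)) (is_deriveX m dV).
  move=> H; apply: is_derive_eq H _.
  rewrite /GRing.scale /= !exprfctE -exprVn.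
  (* For [m = 0] both terms vanish; otherwise one factor [1/t] is split off to match the exponent
     [m.-1] of the derivative. *)
  case: m {HY Z ZE dV} => [|m]; first by rewrite !mul0r !mulr0 addr0.
  rewrite /= [t^-1 ^+ m.+1]exprS.
  move: (Y t) (t^-1) => y u; move: (u ^+ m) (m.+1%:R) => v k.
  exact: first_integral_identity.
have [[t0 St0]|nS] := pselect (exists t, S t); last first.
  by exists 0 => // t St; case: nS; exists t.
have [k k0 ZR] : exists2 k : R, 0 <= k & `|Z t0| = k%:C.
  have := normr_ge0 (Z t0); have := normr_real (Z t0).
  by move=> /complex_realP[k ->]; rewrite ler0c => k0; exists k.
have Y5 t : S t -> `|Y t| ^+ 5 = k%:C * `|t| ^+ m.
  move=> St; rewrite -ZR (sector_cst dZ St0 St) ZE normrM !normrX normfV exprVn divfK//.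
  by rewrite expf_neq0// normr_eq0 (sector_neq0 St).
exists (k + 1); first exact: addr_ge0.
move=> t St t1; apply: le_fifth_power (Y5 t St) => //.
by rewrite exprn_ege1// ltW.
Qed.

End Sector.

End Regular.

(** * Regularity of the Picard-Fuchs system at infinity *)

Section RegularSystem.
Variable R : realType.
Local Notation C := R[i].
Local Open Scope classical_set_scope.

(** For [a = x_15] and [b = x_0] the left side is the derivative of [a - t b]. The coefficients of
    [b] add up to [1/5 + 2/5 + 1 = 8/5], so this combination solves an Euler equation. *)
Lemma resonance_identity (t a b : C) : t != 0 ->
  t^-1 * (8 / 5 * a - t / 5 * b) - (t * (t^-1 * (2 / 5 * b - 0)) + b * 1) =
  t^-1 * (8 / 5 * (a - t * b)).
Proof. by move=> t0; field. Qed.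

Lemma fdeg_le8 (i : 'I_(4 ^ 2)) : (fdeg i <= 8)%N.
Proof.
rewrite /fdeg -[8%N]/(3 + 3).+2 !ltnS leq_add//; last by rewrite -ltnS ltn_pmod.
by rewrite -ltnS ltn_divLR.
Qed.

Lemma regular_pf_matrix : regular_singular_at_infinity (pf_matrix 0 (pfB0 R) (pfB1 R)).
Proof.
move=> rho alpha beta X rho0 _ HX; pose S := sector rho alpha beta.
pose x i t := X t i 0.
have dX i t : S t -> @is_derive C C^o C^o t 1 (x i)
    (t^-1 * ((fdeg i)%:R / 5 * x i t - (t / 5 * x i0 t) *+ (i == i15))).
  move=> St; have t0 := sector_neq0 rho0 St.
  have := HX t St i; rewrite pf_matrixE// -scalemxAl !mxE sum_pfB.
  exact.
(* All rows but the last are decoupled Euler equations. *)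
have bound_low i : i != i15 -> exists2 K : R, 0 <= K &
    forall t, S t -> 1 < `|t| -> `|x i t| <= K%:C * `|t| ^+ fdeg i.
  move=> /negPf ni; apply: euler_equation_growth => // t St.
  by have := dX i t St; rewrite ni mulr0n subr0.
have [K0 K00 bound0] := bound_low i0 isT.
have [K1 K10 bound1] : exists2 K : R, 0 <= K &
    forall t, S t -> 1 < `|t| -> `|x i15 t - t * x i0 t| <= K%:C * `|t| ^+ 8.
  apply: euler_equation_growth => // t St; have t0 := sector_neq0 rho0 St.
  have D0 := dX i0 t St; have D15 := dX i15 t St.
  have Did : @is_derive C C^o C^o t 1 id 1 by exact: is_derive_id.
  have := is_deriveB D15 (is_deriveM Did D0).
  move=> H; apply: is_derive_eq H _.
  rewrite /GRing.scale /= (_ : fdeg i15 = 8%N)// (_ : fdeg i0 = 2%N)// mulr1n mulr0n.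
  by move: (x i15 t) (x i0 t) => a b; exact: resonance_identity.
have bound i : exists2 K : R, 0 <= K &
    forall t, S t -> 1 < `|t| -> `|x i t| <= K%:C * `|t| ^+ 8.
  have [->|ni] := eqVneq i i15; last first.
    have [K K_ge0 HK] := bound_low i ni; exists K => // t St t1.
    apply: le_trans (HK t St t1) _; rewrite ler_wpM2l ?ler0c//.
    by rewrite ler_weXn2l ?fdeg_le8// ltW.
  (* Here [x_15 = (x_15 - t x_0) + t x_0], with summands bounded by multiples of [|t|^8] and
     [|t|^3]. *)
  exists (K1 + K0) => [|t St t1]; first exact: addr_ge0.
  rewrite -[x i15 t](subrK (t * x i0 t)) (le_trans (ler_normD _ _))//.
  rewrite rmorphD mulrDl lerD ?bound1// normrM.
  apply: le_trans (ler_wpM2l (normr_ge0 t) (bound0 t St t1)) _.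
  rewrite mulrCA ler_wpM2l ?ler0c// -exprS.
  by rewrite ler_weXn2l// ltW.
(* One constant is chosen for each row; their sum then serves all rows at once. *)
pose K i := projT1 (cid2 (bound i)).
have K_ge0 i : 0 <= K i by rewrite /K; case: cid2.
have K_bound i t : S t -> 1 < `|t| -> `|x i t| <= (K i)%:C * `|t| ^+ 8.
  by rewrite /K; case: cid2 => ? ? /=; exact.
exists 8%N, (\sum_i K i), 1 => t St t1 i.
apply: le_trans (K_bound i t St t1) _.
by rewrite ler_wpM2r ?exprn_ge0// lecR (bigD1 i)//= lerDl sumr_ge0.
Qed.

End RegularSystem.

Theorem mainTheorem5 (R : realType) :
  exists (n : nat) (H : mpoly 2 R[i]) (w : 'I_(n ^ 2) -> form1 R),
    [/\ (1 <= n)%N,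
        regular_at_infinity n.+1 H,
        (\sum_(i < n ^ 2) form_deg (w i) = n ^ 2 * n.+1)%N,
        generates_quotient H w
      & exists A B0 B1 : 'M[R[i]]_(n ^ 2),
          [/\ picard_fuchs H w A B0 B1,
              regular_singular_at_infinity (pf_matrix A B0 B1)
            & ~ fuchsian_at_infinity (pf_matrix A B0 B1)]].
Proof.
exists 4%N, (fermat R), (wform R); split=> //.
- exact: regular_fermat.
- exact: sum_form_deg.
- exact: generates_wform.
exists 0, (pfB0 R), (pfB1 R); split.
- exact: picard_fuchs_wform.
- exact: regular_pf_matrix.
- exact: not_fuchsian_pf_matrix.
Qed.
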